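(* The Hochschild cohomology $HH^{-1}(A)$ has a $\mathbf{k}$-basis consisting of the classes of the following cocycles in $\mathrm{Hom}(V_1,A)$, each written as the triple of the images of $x,y,z$: (i) $A^{-1}$: $x\mapsto x$, $y\mapsto y$, $z\mapsto 0$; (ii) $B^{-1}(n)$: $x\mapsto y^nx$, $y\mapsto y^{n+1}$, $z\mapsto 0$; (iii) $C^{-1}(n)$: $x\mapsto y^nx$, $y\mapsto -xy^n$, $z\mapsto zxy^{n-1}$; (iv) $D^{-1}(n,i)$: $x\mapsto y^nx$, $y\mapsto -y^ixy^{n-i}$, $z\mapsto 0$; (v) $E^{-1}(n_{0,p+1};m_{1,p})$: $x\mapsto 0$, $y\mapsto y^{n_0}xy^{n_1}z^{m_1}\cdots z^{m_p}xy^{n_{p+1}-1}$, $z\mapsto 0$; (vi) $F^{-1}(n_{1,p+1};m_{1,p})$: $x\mapsto 0$, $y\mapsto y^{n_1}z^{m_1}\cdots z^{m_p}xy^{n_{p+1}-1}$, $z\mapsto 0$; (vii) $G^{-1}(n_{1,p+1};m_{1,p})$: $x\mapsto 0$, $y\mapsto xy^{n_1}z^{m_1}\cdots z^{m_p}xy^{n_{p+1}}$, $z\mapsto -zxy^{n_1}z^{m_1}\cdots z^{m_p}xy^{n_{p+1}-1}$; (viii) $H^{-1}(n_{2,p};m_{1,p})$: $x\mapsto 0$, $y\mapsto 0$, $z\mapsto z^{m_1}\cdots z^{m_p}$; where $1\le i\le n-1$ and $n,p,n_0,n_1,\dots,n_{p+1},m_1,\dots,m_p$ range over positive integers.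
   Context: $\mathbf{k}$ is a field of characteristic $0$, $A=\mathbf{k}\langle x,y,z\rangle/(x^2+yx,\,xz,\,zy)$, $A^e=A\otimes A^{\mathrm{op}}$. Hochschild cohomology is placed in non-positive degrees: $HH^{-n}(A)=\mathrm{Ext}^n_{A^e}(A,A)$. The notation $n_{a,b}$ stands for the sequence $n_a,n_{a+1},\dots,n_b$ (empty if $b<a$). The expression $z^{m_1}\cdots z^{m_p}$ is shorthand for $z^{m_1}xy^{n_2}z^{m_2}xy^{n_3}z^{m_3}\cdots xy^{n_p}z^{m_p}$ (for $p=1$ it is $z^{m_1}$). $A$ is Koszul, and $HH^{\bullet}(A)$ is computed by the cochain complex $0\to A\xrightarrow{d_1^*}\mathrm{Hom}(V_1,A)\xrightarrow{d_2^*}\mathrm{Hom}(V_2,A)\to\cdots$ obtained from the two-sided Koszul resolution, where $V_1=\mathbf{k}\{x,y,z\}$, $V_2=\mathbf{k}\{(x+y)x,xz,zy\}$, $d_1^*(a)$ is $p\mapsto pa-ap$ for $p=x,y,z$, and for $f=(x\mapsto a,\,y\mapsto b,\,z\mapsto c)$ the coboundary $d_2^*(f)$ is $(x+y)x\mapsto (x+y)a+ax+bx$, $xz\mapsto xc+az$, $zy\mapsto zb+cy$. Thus $HH^{-1}(A)=\ker d_2^*/\mathrm{im}\, d_1^*$. *)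

(* Defs.v *)
From HB Require Import structures.
From mathcomp Require Import all_boot all_algebra.
From mathcomp Require Import boolp.
From mathcomp Require Import finmap monalg.

Set Implicit Arguments.
Unset Strict Implicit.
Unset Printing Implicit Defensive.

Import GRing.Theory.
Local Open Scope ring_scope.
Local Open Scope quotient_scope.

Section LmodQuotient.
Variables (R : pzRingType) (V : lmodType R) (I : submodClosed V).

(* [{quot J}] wants a [zmodClosed] predicate; over a ring a [submodClosed] one
   is closed under opposites, but the hierarchy does not record it. *)
Definition lquot_pred : {pred V} := I.

Lemma lquot_zmod_closed : zmod_closed lquot_pred.
Proof.
rewrite /lquot_pred; split=> [|u v uI vI]; first exact: rpred0.
by rewrite -scaleN1r rpredD // rpredZ.
Qed.

HB.instance Definition _ := GRing.isZmodClosed.Build V lquot_pred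
  lquot_zmod_closed.

Definition lquot := Quotient.quot lquot_pred.

HB.instance Definition _ := Choice.on lquot.
HB.instance Definition _ := GRing.Zmodule.on lquot.
HB.instance Definition _ := EqQuotient.on lquot.

Lemma lquot_piD : {morph \pi_lquot : u v / u + v}.
Proof. exact: (raddfD \pi_(Quotient.quot lquot_pred)). Qed.

Lemma lquot_piB : {morph \pi_lquot : u v / u - v}.
Proof. exact: (raddfB \pi_(Quotient.quot lquot_pred)). Qed.

Lemma lquot_piP (u v : V) : \pi_lquot u = \pi_lquot v <-> u - v \in I.
Proof.
have E : (u - v \in lquot_pred) = (u == v %[mod lquot]).
  exact: (@Quotient.idealrBE _ lquot_pred u v).
by split=> [/eqP|h]; [rewrite -E|apply/eqP; rewrite -E].
Qed.

Definition lquot_scale (c : R) (u : lquot) : lquot := \pi_lquot (c *: repr u).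

Lemma lquot_scaleE c (u : V) : lquot_scale c (\pi_lquot u) = \pi_lquot (c *: u).
Proof.
apply/lquot_piP; rewrite -scalerBr rpredZ //.
by apply/lquot_piP; rewrite reprK.
Qed.

Lemma lquot_scalerA a b u :
  lquot_scale a (lquot_scale b u) = lquot_scale (a * b) u.
Proof. by rewrite -[u]reprK (lquot_scaleE b) !lquot_scaleE scalerA. Qed.

Lemma lquot_scale1r : left_id 1 lquot_scale.
Proof. by move=> u; rewrite -[u]reprK lquot_scaleE scale1r. Qed.

Lemma lquot_scalerDr : right_distributive lquot_scale +%R.
Proof.
move=> a u v; rewrite -[u]reprK -[v]reprK.
by rewrite !lquot_scaleE -!lquot_piD lquot_scaleE scalerDr.
Qed.

Lemma lquot_scalerDl (u : lquot) :
  {morph lquot_scale^~ u : a b / a + b}.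
Proof.
by move=> a b; rewrite -[u]reprK !lquot_scaleE -lquot_piD scalerDl.
Qed.

HB.instance Definition _ := GRing.Zmodule_isLmodule.Build R lquot
  lquot_scalerA lquot_scale1r lquot_scalerDr lquot_scalerDl.

End LmodQuotient.

Section Basis.
Variables (k : fieldType) (V : lmodType k) (I : Type) (e : I -> V).

Definition lin_indep :=
  forall (r : nat) (s : 'I_r -> I) (c : 'I_r -> k), injective s ->
    \sum_(j < r) c j *: e (s j) = 0 -> forall j, c j = 0.

Definition spanning :=
  forall v : V, exists (r : nat) (s : 'I_r -> I) (c : 'I_r -> k),
    v = \sum_(j < r) c j *: e (s j).

Definition is_basis := lin_indep /\ spanning.

End Basis.

Section Cohomology.
Variables (k : fieldType) (V0 V1 V2 : lmodType k).
Variables (d1 : {linear V0 -> V1}) (d2 : {linear V1 -> V2}).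

Definition cocycle : {pred V1} := fun f => d2 f == 0.

Lemma cocycle_submod_closed : subsemimod_closed cocycle.
Proof.
split; first split; rewrite /cocycle.
- by rewrite unfold_in linear0.
- by move=> u v; rewrite !unfold_in linearD => /eqP -> /eqP ->; rewrite addr0.
- by move=> a u; rewrite !unfold_in linearZ => /eqP /= ->; rewrite scaler0.
Qed.

HB.instance Definition _ := GRing.isSubmodClosed.Build k V1 cocycle
  cocycle_submod_closed.

Record cocycles := Cocycle { cochain_of : V1; _ : cocycle cochain_of }.

HB.instance Definition _ := [isSub for cochain_of].
HB.instance Definition _ := [Choice of cocycles by <:].
HB.instance Definition _ := [SubChoice_isSubLmodule of cocycles by <:].

Definition coboundary : {pred cocycles} :=
  fun f => `[< exists a : V0, cochain_of f = d1 a >].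

Lemma coboundary_submod_closed : subsemimod_closed coboundary.
Proof.
split; first split.
- by apply/asboolP; exists 0; rewrite [RHS]linear0.
- move=> u v /asboolP[a ua] /asboolP[b vb].
  by apply/asboolP; exists (a + b); rewrite [RHS]linearD -ua -vb.
- move=> c u /asboolP[a ua].
  by apply/asboolP; exists (c *: a); rewrite [RHS]linearZ -ua.
Qed.

HB.instance Definition _ := GRing.isSubmodClosed.Build k cocycles coboundary
  coboundary_submod_closed.

Definition cohomology := lquot coboundary.

HB.instance Definition _ := GRing.Lmodule.on cohomology.

Definition coh_class (f : V1) (hf : cocycle f) : cohomology :=
  \pi_(lquot coboundary) (Cocycle hf).

Lemma coh_class_eq0 (f : V1) (hf : cocycle f) :
  coh_class hf = 0 <-> exists a, f = d1 a.
Proof.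
have -> : 0 = \pi_(lquot coboundary) 0 :> cohomology.
  by apply: (addrI (\pi_(lquot coboundary) 0)); rewrite -lquot_piD !addr0.
split=> [/lquot_piP|h]; [|apply/lquot_piP]; rewrite subr0.
  by move/asboolP.
exact/asboolP.
Qed.

End Cohomology.

Section Ideal.
Variables (k : fieldType) (F : lalgType k) (rels : seq F).

Inductive in_ideal : F -> Prop :=
  | ideal_gen a r b of r \in rels : in_ideal (a * r * b)
  | ideal_zero : in_ideal 0
  | ideal_add u v of in_ideal u & in_ideal v : in_ideal (u + v).

Definition ideal : {pred F} := fun u => `[< in_ideal u >].

Lemma idealP u : reflect (in_ideal u) (u \in ideal).
Proof. exact: asboolP. Qed.

Lemma ideal_mull a u : u \in ideal -> a * u \in ideal.
Proof.
move=> /idealP hu; apply/idealP; elim: hu => [b r c hr||v w _ hv _ hw].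
- by rewrite !mulrA; apply: ideal_gen.
- by rewrite mulr0; apply: ideal_zero.
- by rewrite mulrDr; apply: ideal_add.
Qed.

Lemma ideal_mulr a u : u \in ideal -> u * a \in ideal.
Proof.
move=> /idealP hu; apply/idealP; elim: hu => [b r c hr||v w _ hv _ hw].
- by rewrite -mulrA; apply: ideal_gen.
- by rewrite mul0r; apply: ideal_zero.
- by rewrite mulrDl; apply: ideal_add.
Qed.

Lemma ideal_submod_closed : subsemimod_closed ideal.
Proof.
split; first split.
- exact/idealP/ideal_zero.
- by move=> u v /idealP hu /idealP hv; apply/idealP/ideal_add.
- by move=> a u hu; rewrite -mulr_algl; apply: ideal_mull.
Qed.

HB.instance Definition _ := GRing.isSubmodClosed.Build k F ideal
  ideal_submod_closed.

Lemma ideal_aug (aug : {rmorphism F -> k}) :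
  (forall r, r \in rels -> aug r = 0) -> 1 \notin ideal.
Proof.
move=> h; apply/negP => /idealP h1.
have: aug 1 = 0; last by rewrite rmorph1; apply/eqP/oner_neq0.
elim: h1 => [a r b /h hr||u v _ hu _ hv].
- by rewrite !rmorphM hr mulr0 mul0r.
- exact: rmorph0.
- by rewrite rmorphD hu hv addr0.
Qed.

End Ideal.

Section AlgQuotient.
Variables (k : fieldType) (F : algType k) (rels : seq F).
Variable h1 : 1 \notin ideal rels.

(* The proof argument keeps the quotient nontrivial, as [algType] requires. *)
Definition qalg of 1 \notin ideal rels := lquot (ideal rels).
Local Notation Q := (qalg h1).

HB.instance Definition _ := GRing.Lmodule.on Q.

Definition qpi (f : F) : Q := \pi_(lquot (ideal rels)) f.
Definition qrepr (u : Q) : F := repr (u : lquot (ideal rels)).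

Lemma qreprK (u : Q) : qpi (qrepr u) = u.
Proof. exact: reprK. Qed.

Lemma qpiP f g : qpi f = qpi g <-> f - g \in ideal rels.
Proof. exact: lquot_piP. Qed.

Lemma qpiD : {morph qpi : f g / f + g}.
Proof. exact: lquot_piD. Qed.

Lemma qpiZ c : {morph qpi : f / c *: f}.
Proof. by move=> f; rewrite [RHS]lquot_scaleE. Qed.

Definition qone : Q := qpi 1.
Definition qmul (u v : Q) : Q := qpi (qrepr u * qrepr v).

Lemma qmulE f g : qmul (qpi f) (qpi g) = qpi (f * g).
Proof.
apply/qpiP.
have /qpiP hf := qreprK (qpi f); have /qpiP hg := qreprK (qpi g).
set f' := qrepr _ in hf *; set g' := qrepr _ in hg *.
have -> : f' * g' - f * g = (f' - f) * g' + f * (g' - g).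
  by rewrite mulrBl mulrBr addrA subrK.
by apply: rpredD; [apply: ideal_mulr | apply: ideal_mull].
Qed.

Lemma qmulA : associative qmul.
Proof.
by move=> u v w; rewrite -[u]qreprK -[v]qreprK -[w]qreprK !qmulE mulrA.
Qed.

Lemma qmul1 : left_id qone qmul.
Proof. by move=> u; rewrite -[u]qreprK qmulE mul1r. Qed.

Lemma qmulr1 : right_id qone qmul.
Proof. by move=> u; rewrite -[u]qreprK qmulE mulr1. Qed.

Lemma qmulDl : left_distributive qmul +%R.
Proof.
move=> u v w; rewrite -[u]qreprK -[v]qreprK -[w]qreprK.
by rewrite !qmulE -!qpiD qmulE mulrDl.
Qed.

Lemma qmulDr : right_distributive qmul +%R.
Proof.
move=> u v w; rewrite -[u]qreprK -[v]qreprK -[w]qreprK.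
by rewrite !qmulE -!qpiD qmulE mulrDr.
Qed.

Lemma qone_neq0 : qone != 0.
Proof.
have qpi0 : qpi 0 = 0 by apply: (addrI (qpi 0)); rewrite -qpiD !addr0.
by apply/negP=> /eqP; rewrite -qpi0 => /qpiP; rewrite subr0 (negPf h1).
Qed.

HB.instance Definition _ := GRing.Zmodule_isNzRing.Build Q
  qmulA qmul1 qmulr1 qmulDl qmulDr qone_neq0.

Lemma qpiM : {morph qpi : f g / f * g}.
Proof. by move=> f g; rewrite -[LHS]qmulE. Qed.

Lemma qscalerAl (c : k) (u v : Q) : c *: (u * v) = (c *: u) * v.
Proof.
rewrite -[u]qreprK -[v]qreprK -(qpiZ c (qrepr u)) -!qpiM.
by rewrite -(qpiZ c (_ * _)) scalerAl.
Qed.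

HB.instance Definition _ := GRing.Lmodule_isLalgebra.Build k Q qscalerAl.

Lemma qscalerAr (c : k) (u v : Q) : c *: (u * v) = u * (c *: v).
Proof.
rewrite -[u]qreprK -[v]qreprK -(qpiZ c (qrepr v)) -!qpiM.
by rewrite -(qpiZ c (_ * _)) scalerAr.
Qed.

HB.instance Definition _ := GRing.Lalgebra_isAlgebra.Build k Q qscalerAr.

Lemma qpi_is_linear : linear qpi.
Proof. by move=> c f g; rewrite qpiD qpiZ. Qed.

HB.instance Definition _ := GRing.isLinear.Build k F Q _ qpi qpi_is_linear.
HB.instance Definition _ := GRing.isMonoidMorphism.Build F Q qpi
  (conj (erefl : qpi 1 = 1) qpiM).

Lemma qpi_rel r : r \in rels -> qpi r = 0.
Proof.
move=> hr; rewrite -[RHS](linear0 qpi); apply/qpiP; rewrite subr0.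
by apply/idealP; rewrite -[r]mul1r -[_ * r]mulr1; apply: ideal_gen.
Qed.

End AlgQuotient.

Lemma malg_scalerAr (k : comNzRingType) (K : monomType) (c : k)
  (f g : {malg k[K]}) : c *: (f * g) = f * (c *: g).
Proof.
apply/malgP=> m; rewrite mcoeffZ.
rewrite (mcoeffMlw m (fsubset_refl (msupp f)) (fsubset_refl (msupp g))).
rewrite (mcoeffMlw m (fsubset_refl (msupp f)) (msuppZ_le c g)).
rewrite mulr_sumr; apply: eq_bigr => m1 _; rewrite mulr_sumr.
by apply: eq_bigr => m2 _; rewrite mulrnAr mcoeffZ mulrCA.
Qed.

Section FreeAlgebra.
Variables (k : fieldType) (X : choiceType).

Definition freealg := {malg k[{fmonom X}]}.

HB.instance Definition _ := GRing.Lalgebra.on freealg.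


Lemma freealg_scalerAr (c : k) (f g : freealg) : c *: (f * g) = f * (c *: g).
Proof. exact: malg_scalerAr. Qed.

HB.instance Definition _ := GRing.Lalgebra_isAlgebra.Build k freealg
  freealg_scalerAr.

Definition faug (f : freealg) : k := f@_mone.

Lemma faug_zmod_morphism : zmod_morphism faug.
Proof. exact: mcoeffB. Qed.

Lemma faug_monoid_morphism : monoid_morphism faug.
Proof.
by have [hM h1] := mcoeff1g_is_multiplicative {fmonom X} k; split.
Qed.

HB.instance Definition _ := GRing.isZmodMorphism.Build freealg k faug
  faug_zmod_morphism.
HB.instance Definition _ := GRing.isMonoidMorphism.Build freealg k faug
  faug_monoid_morphism.

Lemma faugD f g : faug (f + g) = faug f + faug g.
Proof. exact: rmorphD. Qed.

Lemma faugM f g : faug (f * g) = faug f * faug g.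
Proof. exact: rmorphM. Qed.

End FreeAlgebra.

Section FreeGenerators.
Variables (k : fieldType) (X : choiceType).

Definition fgen (i : X) : freealg k X := << fmu i >>.

Lemma faug_gen i : faug (fgen i) = 0.
Proof. by rewrite /faug mcoeffU1 -val_eqE /= fmU fm1. Qed.

End FreeGenerators.

(* Names of the proposed basis elements.  A sequence [n_{a,b}] is a [seq nat]
   whose entry at position 0 is [n_a]; [p] is the size of the sequence [ms]. *)
Inductive hh1_name :=
  | cocA
  | cocB of nat
  | cocC of nat
  | cocD of nat & nat
  | cocE of seq nat & seq nat
  | cocF of seq nat & seq nat
  | cocG of seq nat & seq nat
  | cocH of seq nat & seq nat.

Definition all_pos (s : seq nat) : bool := all (fun j => 0 < j)%N s.

Definition hh1_range (i : hh1_name) : bool :=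
  match i with
  | cocA => true
  | cocB n | cocC n => 1 <= n
  | cocD n i => 1 <= i <= n.-1
  | cocE ns ms => [&& 1 <= size ms, size ns == size ms + 2, all_pos ns & all_pos ms]
  | cocF ns ms | cocG ns ms =>
      [&& 1 <= size ms, size ns == size ms + 1, all_pos ns & all_pos ms]
  | cocH ns ms =>
      [&& 1 <= size ms, size ns == size ms - 1, all_pos ns & all_pos ms]
  end%N.

Definition hh1_index := {i : hh1_name | hh1_range i}.

(* The entry of index [j] in a sequence whose first entry has index [a]. *)
Definition from (a : nat) (s : seq nat) (j : nat) : nat := nth 0%N s (j - a).

Section KoszulComplex.
Variables (k : fieldType) (A : algType k) (x y z : A).

(* [Hom(V_1, A)] and [Hom(V_2, A)] are triples: the values on the bases
   [x, y, z] of [V_1] and [(x + y) x, x z, z y] of [V_2]. *)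
Definition cochain := (A * A * A)%type.

Definition koszul_d1 (a : A) : cochain :=
  (x * a - a * x, y * a - a * y, z * a - a * z).

Definition koszul_d2 (f : cochain) : cochain :=
  let: (a, b, c) := f in
  ((x + y) * a + a * x + b * x, x * c + a * z, z * b + c * y).

Lemma koszul_d1_linear : linear koszul_d1.
Proof.
move=> t u v; congr (_, _, _);
by rewrite mulrDr mulrDl -scalerAr -scalerAl opprD addrACA -scalerBr.
Qed.

Lemma koszul_d2_linear : linear koszul_d2.
Proof.
move=> t [[a b] c] [[a' b'] c']; congr (_, _, _);
  rewrite /= !(mulrDr, mulrDl) -!scalerAr -!scalerAl ?scalerDr.
- by rewrite [LHS](AC (2*2*2*2) (1*2*5*7*(3*4*6*8))).
- by rewrite addrACA.
- by rewrite addrACA.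
Qed.

HB.instance Definition _ := GRing.isLinear.Build k A cochain _ koszul_d1
  koszul_d1_linear.
HB.instance Definition _ := GRing.isLinear.Build k cochain cochain _ koszul_d2
  koszul_d2_linear.

Lemma koszul_d2_d1 (a : A) : x ^+ 2 + y * x = 0 -> x * z = 0 -> z * y = 0 ->
  koszul_d2 (koszul_d1 a) = 0.
Proof.
rewrite expr2 -mulrDl => hyx hxz hzy; congr (_, _, _).
- have e : (x * a - a * x) * x + (y * a - a * y) * x =
           (x + y) * a * x - a * ((x + y) * x).
    by rewrite -mulrDl addrACA -opprD -mulrDl -mulrDr mulrBl !mulrA.
  by rewrite -addrA e hyx mulr0 subr0 mulrBr !mulrA hyx mul0r sub0r addNr.
- by rewrite mulrBr mulrBl !mulrA hxz mul0r sub0r -[a * x * z]mulrA hxz mulr0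
             subr0 addrC subrr.
- by rewrite mulrBr mulrBl !mulrA hzy mul0r sub0r -[a * z * y]mulrA hzy mulr0
             subr0 addrC subrr.
Qed.

(* For the algebra [algA] below, whose Koszul complex this is, the quotient is
   [HH^{-1} = Ext^1_{A^e}(A, A)]. *)
Definition HHm1 := cohomology koszul_d1 koszul_d2.

HB.instance Definition _ := GRing.Lmodule.on HHm1.

Definition HHm1_class (f : cochain) (hf : cocycle koszul_d2 f) : HHm1 :=
  coh_class koszul_d1 hf.

(* [z^{m_1} x y^{n_2} z^{m_2} ... x y^{n_p} z^{m_p}], the first block having index 1. *)
Definition zword (p : nat) (n m : nat -> nat) : A :=
  z ^+ m 1%N * \prod_(2 <= j < p.+1) (x * y ^+ n j * z ^+ m j).

Definition hh1_cochain (i : hh1_index) : cochain :=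
  match val i with
  | cocA => (x, y, 0)
  | cocB n => (y ^+ n * x, y ^+ n.+1, 0)
  | cocC n => (y ^+ n * x, - (x * y ^+ n), z * x * y ^+ n.-1)
  | cocD n i => (y ^+ n * x, - (y ^+ i * x * y ^+ (n - i)), 0)
  | cocE ns ms =>
      let p := size ms in let n := from 0 ns in let m := from 1 ms in
      (0, y ^+ n 0%N * x * y ^+ n 1%N * zword p n m * x * y ^+ (n p.+1).-1, 0)
  | cocF ns ms =>
      let p := size ms in let n := from 1 ns in let m := from 1 ms in
      (0, y ^+ n 1%N * zword p n m * x * y ^+ (n p.+1).-1, 0)
  | cocG ns ms =>
      let p := size ms in let n := from 1 ns in let m := from 1 ms in
      (0, x * y ^+ n 1%N * zword p n m * x * y ^+ n p.+1,
       - (z * x * y ^+ n 1%N * zword p n m * x * y ^+ (n p.+1).-1))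
  | cocH ns ms =>
      let p := size ms in let n := from 2 ns in let m := from 1 ms in
      (0, 0, zword p n m)
  end.

End KoszulComplex.

Section Algebra.
Variable k : fieldType.

Definition Fx : freealg k 'I_3 := fgen k (Ordinal (isT : (0 < 3)%N)).
Definition Fy : freealg k 'I_3 := fgen k (Ordinal (isT : (1 < 3)%N)).
Definition Fz : freealg k 'I_3 := fgen k (Ordinal (isT : (2 < 3)%N)).

Definition rels (F : lalgType k) (x y z : F) : seq F :=
  [:: x ^+ 2 + y * x; x * z; z * y].

Lemma rels_proper (F : lalgType k) (aug : {rmorphism F -> k}) (x y z : F) :
  aug x = 0 -> aug z = 0 -> 1 \notin ideal (rels x y z).
Proof.
move=> hx hz; apply: (ideal_aug (aug := aug)) => r.
rewrite !inE => /or3P[] /eqP ->.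
- by rewrite rmorphD expr2 !rmorphM /= hx !mulr0 addr0.
- by rewrite rmorphM /= hx mul0r.
- by rewrite rmorphM /= hz mul0r.
Qed.

Lemma rels_qpi (F : algType k) (x y z : F) (h : 1 \notin ideal (rels x y z))
    (q := qpi h) :
  [/\ q x ^+ 2 + q y * q x = 0, q x * q z = 0 & q z * q y = 0].
Proof.
rewrite /q !expr2 -!qpiM -qpiD -expr2.
by split; apply: qpi_rel; rewrite !inE eqxx ?orbT.
Qed.

Lemma algA_proper : 1 \notin ideal (rels Fx Fy Fz).
Proof. exact: (@rels_proper _ (@faug k 'I_3) _ _ _ (faug_gen _ _) (faug_gen _ _)). Qed.

Definition algA : algType k := qalg algA_proper.

Definition xA : algA := qpi algA_proper Fx.
Definition yA : algA := qpi algA_proper Fy.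
Definition zA : algA := qpi algA_proper Fz.

Lemma algA_rels : [/\ xA ^+ 2 + yA * xA = 0, xA * zA = 0 & zA * yA = 0].
Proof. exact: rels_qpi. Qed.

End Algebra.

(* Main.v *)
(** The rewriting system x y^n x -> - y^(n+1) x, x z -> 0, z y -> 0 is confluent,
    which gives a basis of normal words of A: the free algebra acts on the span of
    these words through the rules, and the action of a on the word 1 is the vector
    of coordinates of a.  On words the Koszul differentials are signed
    substitutions, and a discrete Morse argument applies.  Modulo coboundaries
    every cochain is a combination of good words; a good word differs from its
    projection to the span of the proposed cocycles by g (d_2 f) for an explicit
    linear map g, so a cocycle made of good words lies in that span.  Conversely
    an explicit h with h (d_1 a) = a up to constants kills the proposed cocycles,
    so no nontrivial combination of them is a coboundary. *)

Require Import Defs.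
From HB Require Import structures.
From mathcomp Require Import all_boot all_algebra.
From mathcomp Require Import boolp finmap monalg.

Set Implicit Arguments.
Unset Strict Implicit.
Unset Printing Implicit Defensive.

Import GRing.Theory.
Local Open Scope ring_scope.

(** * Linear maps out of a free module, prescribed on its basis *)

Section LinearExtension.
Variables (k : fieldType) (T : choiceType).

Section Extension.
Variables (V : lmodType k) (f : T -> V).

Definition lin_ext (u : {malg k[T]}) : V := \sum_(t <- msupp u) u@_t *: f t.

Lemma lin_extEw (d : {fset T}) (u : {malg k[T]}) : (msupp u `<=` d)%fset ->
  lin_ext u = \sum_(t <- d) u@_t *: f t.
Proof.
move=> le; rewrite /lin_ext [LHS](big_fset_incl _ le) // => t _.
by move/mcoeff_outdom->; rewrite scale0r.
Qed.

Lemma lin_ext_linear : linear lin_ext.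
Proof.
move=> c u v; pose d := (msupp u `|` msupp v `|` msupp (c *: u + v))%fset.
have du : (msupp u `<=` d)%fset by rewrite /d -fsetUA fsubsetUl.
have dv : (msupp v `<=` d)%fset by rewrite /d fsetUAC fsubsetUr.
have dw : (msupp (c *: u + v) `<=` d)%fset by rewrite /d fsubsetUr.
rewrite (lin_extEw du) (lin_extEw dv) (lin_extEw dw) scaler_sumr -big_split /=.
by apply: eq_bigr => t _; rewrite mcoeffD mcoeffZ scalerDl scalerA.
Qed.

HB.instance Definition _ := GRing.isLinear.Build k {malg k[T]} V _ lin_ext
  lin_ext_linear.

Lemma lin_extZU c t : lin_ext << c *g t >> = c *: f t.
Proof. by rewrite (lin_extEw msuppU_le) big_seq_fset1 mcoeffUU. Qed.

Lemma lin_extU t : lin_ext << t >> = f t.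
Proof. by rewrite lin_extZU scale1r. Qed.

Lemma lin_ext0 : lin_ext 0 = 0.
Proof. exact: linear0. Qed.

Lemma lin_extN u : lin_ext (- u) = - lin_ext u.
Proof. exact: linearN. Qed.

Definition lin_extE := (lin_extU, lin_ext0, lin_extN).

End Extension.

Lemma malg_sumU (u : {malg k[T]}) : u = \sum_(t <- msupp u) u@_t *: << t >>.
Proof.
rewrite {1}[u]monalgE; apply: eq_bigr => t _; apply/malgP => s.
by rewrite mcoeffZ !mcoeffU mulr_natr.
Qed.

End LinearExtension.

(* [Wy n] is y^n, [Wyx n m] is y^n x y^m, and [Wz n l s q] is
   y^n (gap l) z (gap s_1) z ... (gap s_r) z (tail q), where [gap 0] and [tail 0]
   are 1, [gap l] is x y^l for l > 0, and [tail q.+1] is x y^q. *)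
Inductive word :=
  | Wy of nat
  | Wyx of nat & nat
  | Wz of nat & nat & seq nat & nat.

HB.instance Definition _ := gen_eqMixin word.
HB.instance Definition _ := gen_choiceMixin word.

(** * Products of a letter and a normal word, on either side *)

Section Words.
Variables (k : fieldType) (A : algType k) (x y z : A).
Hypotheses (xx : x ^+ 2 + y * x = 0) (xz : x * z = 0) (zy : z * y = 0).

(** Since x z = 0, the exponent of y between an x and the next z is positive, so 0 is free to encode
    an empty gap. After the last z a lone x survives, whence the shift in [tail]. *)
Definition gap (l : nat) : A := if l is 0 then 1 else x * y ^+ l.
Definition tail (q : nat) : A := if q is q'.+1 then x * y ^+ q' else 1.
Definition zchain (s : seq nat) : A := z * \prod_(i <- s) (gap i * z).

Definition wordA (w : word) : A :=
  match w with
  | Wy n => y ^+ n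
  | Wyx n m => y ^+ n * x * y ^+ m
  | Wz n l s q => y ^+ n * gap l * zchain s * tail q
  end.
Local Notation "«  w »" := (wordA w).

(** Completing the rule x^2 -> - y x yields this infinite family; each member follows from the
    previous one by trading y x for - x^2. *)
Lemma x_yn_x n : x * y ^+ n * x = - (y ^+ n.+1 * x).
Proof.
elim: n => [|n IHn].
  by rewrite expr0 mulr1 expr1 -expr2; apply/eqP; rewrite -addr_eq0 xx.
have yx : y * x = - (x ^+ 2) by apply/eqP; rewrite -addr_eq0 addrC xx.
rewrite exprSr mulrA -mulrA yx mulrN expr2 mulrA IHn mulNr opprK.
rewrite -mulrA -expr2 -[x ^+ 2]opprK -yx mulrN [in RHS]exprSr -mulrA //.
Qed.

Lemma xWy n : x * « Wy n » = « Wyx 0 n ».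
Proof. by rewrite /= mul1r. Qed.
Lemma xWyx n m : x * « Wyx n m » = - « Wyx n.+1 m ».
Proof. by rewrite /= !mulrA x_yn_x !mulNr. Qed.
Lemma xWz00 s q : x * « Wz 0 0 s q » = 0.
Proof. by rewrite /= /zchain !mul1r !mulrA xz !mul0r. Qed.
Lemma xWzS0 n s q : x * « Wz n.+1 0 s q » = « Wz 0 n.+1 s q ».
Proof. by rewrite /= mulr1 mul1r !mulrA. Qed.
Lemma xWzS n l s q : x * « Wz n l.+1 s q » = - « Wz n.+1 l.+1 s q ».
Proof. by rewrite /= !mulrA x_yn_x !mulNr. Qed.
Definition xWE := (xWy, xWyx, xWz00, xWzS0, xWzS).

Lemma yWy n : y * « Wy n » = « Wy n.+1 ».
Proof. by rewrite /= exprS. Qed.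
Lemma yWyx n m : y * « Wyx n m » = « Wyx n.+1 m ».
Proof. by rewrite /= exprS !mulrA. Qed.
Lemma yWz n l s q : y * « Wz n l s q » = « Wz n.+1 l s q ».
Proof. by rewrite /= exprS !mulrA. Qed.
Definition yWE := (yWy, yWyx, yWz).

Lemma z_yS n : z * y ^+ n.+1 = 0.
Proof. by rewrite exprS mulrA zy mul0r. Qed.

Lemma zWy0 : z * « Wy 0 » = « Wz 0 0 [::] 0 ».
Proof. by rewrite /= /zchain big_nil !mulr1 !mul1r. Qed.
Lemma zWyS n : z * « Wy n.+1 » = 0.
Proof. exact: z_yS. Qed.
Lemma zWyx0 m : z * « Wyx 0 m » = « Wz 0 0 [::] m.+1 ».
Proof. by rewrite /= /zchain big_nil !mulr1 !mul1r. Qed.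
Lemma zWyxS n m : z * « Wyx n.+1 m » = 0.
Proof. by rewrite /= !mulrA z_yS !mul0r. Qed.
Lemma zWz0 l s q : z * « Wz 0 l s q » = « Wz 0 0 (l :: s) q ».
Proof. by rewrite /= /zchain big_cons !mul1r !mulrA. Qed.
Lemma zWzS n l s q : z * « Wz n.+1 l s q » = 0.
Proof. by rewrite /= !mulrA z_yS !mul0r. Qed.
Definition zWE := (zWy0, zWyS, zWyx0, zWyxS, zWz0, zWzS).

Lemma zchain_y s n : zchain s * y ^+ n.+1 = 0.
Proof.
elim/last_ind: s => [|s l _]; first by rewrite /zchain big_nil mulr1 z_yS.
by rewrite /zchain -cats1 big_cat big_seq1 /= -!mulrA z_yS !mulr0.
Qed.

Lemma zchain_rcons s l : zchain (rcons s l) = zchain s * gap l * z.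
Proof. by rewrite /zchain -cats1 big_cat big_seq1 /= !mulrA. Qed.

Lemma Wyx_ n : « Wy n » * x = « Wyx n 0 ».
Proof. by rewrite /= mulr1. Qed.
Lemma Wyxx n m : « Wyx n m » * x = - « Wyx (n + m).+1 0 ».
Proof.
by rewrite /= -!mulrA [x * _]mulrA x_yn_x mulr1 mulrN mulrA -exprD addnS.
Qed.
Lemma Wz0x n l s : « Wz n l s 0 » * x = « Wz n l s 1 ».
Proof. by rewrite /= !mulr1. Qed.
Lemma WzSx n l s q : « Wz n l s q.+1 » * x = 0.
Proof.
(* Reducing x y^q x puts a positive power of y right after the last z, which kills it. *)
rewrite /= -[LHS]mulrA x_yn_x mulrN mulrA -(mulrA _ (zchain s)) zchain_y.
by rewrite mulr0 mul0r oppr0.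
Qed.
Definition WxE := (Wyx_, Wyxx, Wz0x, WzSx).

Lemma Wyy n : « Wy n » * y = « Wy n.+1 ».
Proof. by rewrite /= exprSr. Qed.
Lemma Wyxy n m : « Wyx n m » * y = « Wyx n m.+1 ».
Proof. by rewrite /= exprSr !mulrA. Qed.
Lemma Wz0y n l s : « Wz n l s 0 » * y = 0.
Proof. by rewrite /= mulr1 -mulrA (zchain_y s 0) mulr0. Qed.
Lemma WzSy n l s q : « Wz n l s q.+1 » * y = « Wz n l s q.+2 ».
Proof. by rewrite /= exprSr !mulrA. Qed.
Definition WyE := (Wyy, Wyxy, Wz0y, WzSy).

Lemma Wyz n : « Wy n » * z = « Wz n 0 [::] 0 ».
Proof. by rewrite /= /zchain big_nil !mulr1. Qed.
Lemma Wyxz0 n : « Wyx n 0 » * z = 0.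
Proof. by rewrite /= mulr1 -mulrA xz mulr0. Qed.
Lemma WyxzS n m : « Wyx n m.+1 » * z = « Wz n m.+1 [::] 0 ».
Proof. by rewrite /= /zchain big_nil !mulr1 !mulrA. Qed.
Lemma Wz0z n l s : « Wz n l s 0 » * z = « Wz n l (rcons s 0) 0 ».
Proof. by rewrite /= zchain_rcons !mulr1 !mulrA. Qed.
Lemma Wz1z n l s : « Wz n l s 1 » * z = 0.
Proof. by rewrite /= mulr1 -mulrA xz mulr0. Qed.
Lemma WzSz n l s q : « Wz n l s q.+2 » * z = « Wz n l (rcons s q.+1) 0 ».
Proof. by rewrite /= zchain_rcons !mulr1 !mulrA. Qed.
Definition WzE := (Wyz, Wyxz0, WyxzS, Wz0z, Wz1z, WzSz).

End Words.

(** * Left actions of a free algebra, given by one operator per letter *)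

Section FreeAction.
Variables (k : fieldType) (X : choiceType) (V : lmodType k).
Variable L : X -> {linear V -> V}.

Definition fm_act (m : {fmonom X}) (v : V) : V := foldr (fun i => L i) v m.
Definition free_act (v : V) (f : freealg k X) : V :=
  lin_ext (fun m : {fmonom X} => fm_act m v) f.

HB.instance Definition _ v := GRing.isLinear.Build k (freealg k X) V _
  (free_act v) (lin_ext_linear _).

Lemma fm_act_linear m : linear (fm_act m).
Proof.
move=> c u v; rewrite /fm_act; elim: (m : seq X) => //= i s ->.
by rewrite linearP.
Qed.

HB.instance Definition _ m := GRing.isLinear.Build k V V _ (fm_act m)
  (fm_act_linear m).

Lemma free_actM v f g : free_act v (f * g) = free_act (free_act v g) f.
Proof.
rewrite /free_act [f * g]malgME linear_sum [in RHS]/lin_ext /=.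
apply: eq_bigr => a _; rewrite !linear_sum /=; apply: eq_bigr => b _.
by rewrite linearZ /= lin_extZU scalerA /fm_act fmM foldr_cat.
Qed.

Lemma free_actD v f g : free_act v (f + g) = free_act v f + free_act v g.
Proof. exact: linearD. Qed.

Lemma free_act1 v : free_act v 1 = v.
Proof. by rewrite /free_act lin_extU /fm_act fm1. Qed.

Lemma free_act0 f : free_act 0 f = 0.
Proof. by rewrite /free_act /lin_ext big1 // => m _; rewrite linear0 scaler0. Qed.

Lemma free_act_gen v i : free_act v (fgen k i) = L i v.
Proof. by rewrite /free_act lin_extU /fm_act fmU. Qed.

(** The generators must act by zero on every vector: in a r b the factor b moves the vector before r
    meets it. *)
Lemma free_act_ideal (rs : seq (freealg k X)) :
    (forall r v, r \in rs -> free_act v r = 0) ->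
  forall f v, f \in ideal rs -> free_act v f = 0.
Proof.
move=> h f v /idealP hf.
elim: hf v => [a r b hr v||u w _ hu _ hw v].
- by rewrite !free_actM (h r) // free_act0.
- by move=> v; rewrite linear0.
- by rewrite linearD /= hu hw addr0.
Qed.

(** Equivariance passes from letters to monomials by induction on the length, then to the whole free
    algebra by linearity. *)
Lemma free_act_eval (B : algType k) (q : {linear freealg k X -> B})
    (e : {linear V -> B}) :
    q 1 = 1 -> {morph q : f g / f * g} ->
    (forall i u, e (L i u) = q (fgen k i) * e u) ->
  forall v f, e (free_act v f) = q f * e v.
Proof.
move=> q1 qM eL v f.
have evm (s : seq X) : e (fm_act (FMonom s) v) = q << FMonom s >> * e v.
  elim: s => [|i s IHs].
    have -> : << FMonom [::] >> = 1 :> freealg k X by rewrite -fmoneE.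
    by rewrite q1 mul1r.
  rewrite [LHS]eL [X in _ * X]IHs mulrA -qM; congr (q _ * _).
  rewrite /fgen malgM_def fgmulUU mulr1 fmuE; congr << _ >>.
  by apply: val_inj; rewrite /= fmM.
rewrite [f in RHS]malg_sumU /free_act /lin_ext !linear_sum mulr_suml /=.
apply: eq_bigr => m _; rewrite !linearZ /= -scalerAl; congr (_ *: _).
by case: m => s; apply: evm.
Qed.

End FreeAction.

(** * The normal words form a basis of [algA] *)

Section NormalForm.
Variable k : fieldType.
Local Notation V := {malg k[word]}.
Local Notation A := (algA k).
Local Notation x := (xA k).
Local Notation y := (yA k).
Local Notation z := (zA k).
Local Notation "«  w »" := (wordA x y z w).

(** [actx], [acty] and [actz] copy the rules [xWE], [yWE] and [zWE] to formal words, whose linear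
    independence holds by construction. *)
Definition actx (w : word) : V :=
  match w with
  | Wy n => << Wyx 0 n >>
  | Wyx n m => - << Wyx n.+1 m >>
  | Wz 0 0 s q => 0
  | Wz n.+1 0 s q => << Wz 0 n.+1 s q >>
  | Wz n l.+1 s q => - << Wz n.+1 l.+1 s q >>
  end.
Definition acty (w : word) : V :=
  match w with
  | Wy n => << Wy n.+1 >>
  | Wyx n m => << Wyx n.+1 m >>
  | Wz n l s q => << Wz n.+1 l s q >>
  end.
Definition actz (w : word) : V :=
  match w with
  | Wy 0 => << Wz 0 0 [::] 0 >>
  | Wyx 0 m => << Wz 0 0 [::] m.+1 >>
  | Wz 0 l s q => << Wz 0 0 (l :: s) q >>
  | _ => 0
  end.

Lemma scaler_eq0l (c : k) (v : V) : v = 0 -> c *: v = 0.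
Proof. by move->; rewrite scaler0. Qed.

(** By linearity it suffices to check the three relations on each word; this check takes the place
    of resolving the overlaps of the rewriting system. *)
Lemma rels_act0 (F : lalgType k) (a : V -> F -> V) (X Y Z : F) :
    (forall v f g, a v (f + g) = a v f + a v g) ->
    (forall v f g, a v (f * g) = a (a v g) f) ->
    (forall v, a v X = lin_ext actx v) -> (forall v, a v Y = lin_ext acty v) ->
    (forall v, a v Z = lin_ext actz v) ->
  forall r v, r \in rels X Y Z -> a v r = 0.
Proof.
move=> aD aM aX aY aZ r v.
rewrite !inE => /or3P[] /eqP ->.
- rewrite aD expr2 !aM !aX aY.
  rewrite [v]malg_sumU !linear_sum -big_split /= big1 // => w _.
  rewrite !linearZ -scalerDr /=; apply: scaler_eq0l; case: w => [n|n m|[|n] [|l] s q] /=;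
    by rewrite !lin_extE /= ?opprK ?addr0 ?addNr ?addrN.
- rewrite aM aX aZ; rewrite [v]malg_sumU !linear_sum /= big1 // => w _.
  rewrite !linearZ /=; apply: scaler_eq0l; case: w => [[|n]|[|n] m|[|n] [|l] s q] /=;
    by rewrite !lin_extE.
- rewrite aM aY aZ; rewrite [v]malg_sumU !linear_sum /= big1 // => w _.
  rewrite !linearZ /=; apply: scaler_eq0l; case: w => [[|n]|[|n] m|[|n] [|l] s q] /=;
    by rewrite !lin_extE.
Qed.

Lemma eval_letter (B : algType k) (x y z c : B) (g : word -> V) :
    (forall w, lin_ext (wordA x y z) (g w) = c * wordA x y z w) ->
  forall u, lin_ext (wordA x y z) (lin_ext g u) = c * lin_ext (wordA x y z) u.
Proof.
move=> h u; rewrite [lin_ext g u]/lin_ext [in RHS]/lin_ext linear_sum mulr_sumr.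
by apply: eq_bigr => w _; rewrite linearZ -scalerAr /= h.
Qed.

Section EvalLetters.
Variables (B : algType k) (x y z : B).
Hypotheses (xx : x ^+ 2 + y * x = 0) (xz : x * z = 0) (zy : z * y = 0).
Let eval : V -> B := lin_ext (wordA x y z).

Lemma eval_actx u : eval (lin_ext actx u) = x * eval u.
Proof.
apply: eval_letter; case=> [n|n m|[|n] [|l] s q];
  by rewrite (xWE xx xz) !lin_extE.
Qed.

Lemma eval_acty u : eval (lin_ext acty u) = y * eval u.
Proof. by apply: eval_letter; case=> [n|n m|n l s q]; rewrite yWE !lin_extE. Qed.

Lemma eval_actz u : eval (lin_ext actz u) = z * eval u.
Proof.
by apply: eval_letter; case=> [[|n]|[|n] m|[|n] l s q]; rewrite (zWE x zy) !lin_extE.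
Qed.

End EvalLetters.

Definition letter_act (i : 'I_3) : {linear V -> V} :=
  match val i with
  | 0 => lin_ext actx
  | 1 => lin_ext acty
  | _ => lin_ext actz
  end%N.

Let act := free_act letter_act.

Lemma act_x v : act v (Fx k) = lin_ext actx v.
Proof. exact: free_act_gen. Qed.
Lemma act_y v : act v (Fy k) = lin_ext acty v.
Proof. exact: free_act_gen. Qed.
Lemma act_z v : act v (Fz k) = lin_ext actz v.
Proof. exact: free_act_gen. Qed.

Lemma act_rels r v : r \in rels (Fx k) (Fy k) (Fz k) -> act v r = 0.
Proof.
by move: r v; apply: rels_act0 (free_actD _) (free_actM _) act_x act_y act_z.
Qed.

(** The choice of a representative is harmless by [coord_qpi], because the ideal acts by zero. *)
Definition coord (a : A) : V := act << Wy 0 >> (qrepr a).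

Lemma coord_qpi f : coord (qpi (algA_proper k) f) = act << Wy 0 >> f.
Proof.
apply/eqP; rewrite -subr_eq0 -linearB /=; apply/eqP.
exact/(free_act_ideal act_rels)/(qpiP (algA_proper k))/qreprK.
Qed.

Lemma coord_linear : linear coord.
Proof.
move=> c u v; rewrite -[u]qreprK -[v]qreprK.
rewrite -(linearP (qpi (algA_proper k))) !coord_qpi; exact: linearP.
Qed.

HB.instance Definition _ := GRing.isLinear.Build k A V _ coord coord_linear.

Lemma coordM f a : coord (qpi (algA_proper k) f * a) = act (coord a) f.
Proof. by rewrite -[a]qreprK -rmorphM /= !coord_qpi; exact: free_actM. Qed.

Lemma coordx a : coord (x * a) = lin_ext actx (coord a).
Proof. by rewrite coordM act_x. Qed.
Lemma coordy a : coord (y * a) = lin_ext acty (coord a).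
Proof. by rewrite coordM act_y. Qed.
Lemma coordz a : coord (z * a) = lin_ext actz (coord a).
Proof. by rewrite coordM act_z. Qed.

Lemma coord1 : coord 1 = << Wy 0 >>.
Proof. by rewrite -(rmorph1 (qpi (algA_proper k))) coord_qpi /act free_act1. Qed.

Lemma coord_yn n : coord (y ^+ n) = << Wy n >>.
Proof.
elim: n => [|n IHn]; first by rewrite expr0 coord1.
by rewrite exprS coordy IHn lin_extU.
Qed.

Lemma coord_yn_mul (f : nat -> word) a :
    (forall n, acty (f n) = << f n.+1 >>) -> coord a = << f 0%N >> ->
  forall n, coord (y ^+ n * a) = << f n >>.
Proof.
move=> fS f0; elim=> [|n IHn]; first by rewrite expr0 mul1r.
by rewrite exprS -mulrA coordy IHn lin_extU.
Qed.

Lemma coord_yx n m : coord (y ^+ n * x * y ^+ m) = << Wyx n m >>.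
Proof.
rewrite -mulrA; apply: (coord_yn_mul (f := fun n => Wyx n m)) => //.
by rewrite coordx coord_yn lin_extU.
Qed.

Lemma coord_gap l s q : coord (zchain x y z s * tail x y q) = << Wz 0 0 s q >> ->
  coord (gap x y l * (zchain x y z s * tail x y q)) = << Wz 0 l s q >>.
Proof.
case: l => [|l] h /=; first by rewrite mul1r.
rewrite -mulrA coordx (coord_yn_mul (f := fun n => Wz n 0 s q)) //.
by rewrite lin_extU.
Qed.

Lemma coord_zchain s q : coord (zchain x y z s * tail x y q) = << Wz 0 0 s q >>.
Proof.
elim: s => [|l s IHs].
  rewrite /zchain big_nil mulr1 coordz; case: q => [|q] /=.
    by rewrite coord1 lin_extU.
  by rewrite coordx coord_yn !lin_extU.
rewrite /zchain big_cons -!mulrA coordz [z * _]mulrA -/(zchain x y z s).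
by rewrite coord_gap // lin_extU.
Qed.

(** When a normal word is built from right to left, no letter ever triggers a sign or a zero, so the
    action on 1 just spells the word. Linear independence of the normal words follows. *)
Lemma coordW w : coord « w » = << w >>.
Proof.
case: w => [n|n m|n l s q]; [exact: coord_yn | exact: coord_yx |].
rewrite /= -mulrA -mulrA; apply: (coord_yn_mul (f := fun n => Wz n l s q)) => //.
exact/coord_gap/coord_zchain.
Qed.

Let eval : {linear V -> A} := lin_ext (wordA x y z).

Lemma eval_act v f : eval (act v f) = qpi (algA_proper k) f * eval v.
Proof.
have [xx xz zy] := algA_rels k.
have ev (i : 'I_3) u :
    eval (letter_act i u) = qpi (algA_proper k) (fgen k i) * eval u.
  case: i => [[|[|[|//]]] i3]; rewrite (eq_irrelevance i3 isT).
  - exact: (eval_actx xx xz).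
  - exact: eval_acty.
  - exact: (eval_actz x zy).
exact: (free_act_eval (erefl : qpi (algA_proper k) 1 = 1) (qpiM _) ev).
Qed.

(** The spanning half: evaluation intertwines the action with left multiplication, so the action of
    a on the word 1 evaluates to a. *)
Lemma coordK : cancel coord (lin_ext (wordA x y z)).
Proof.
move=> a; rewrite -[a in RHS]qreprK.
by rewrite [LHS]eval_act [eval _](lin_extU (wordA x y z) (Wy 0)) mulr1.
Qed.

End NormalForm.

(* [JB 0] is the class A^{-1}.  [JE n l s q] is of type E for l > 0 and of type F
   for l = 0. *)
Inductive hh1_class_name :=
  | JB of nat
  | JC of nat
  | JD of nat & nat
  | JE of nat & nat & seq nat & nat
  | JG of nat & seq nat & nat
  | JH of seq nat.

HB.instance Definition _ := gen_eqMixin hh1_class_name.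
HB.instance Definition _ := gen_choiceMixin hh1_class_name.

Arguments wordA : simpl never.

(** * Koszul cochains over an algebra with a basis of normal words *)

Section Homotopy.
Variables (k : fieldType) (A : algType k) (x y z : A).
Hypotheses (xx : x ^+ 2 + y * x = 0) (xz : x * z = 0) (zy : z * y = 0).
Local Notation "«  w »" := (wordA x y z w).
Variable coord : {linear A -> {malg k[word]}}.
Hypothesis coordW : forall w, coord « w » = << w >>.
Hypothesis coordK : cancel coord (lin_ext (wordA x y z)).

Local Notation J := hh1_class_name.
Local Notation C1 := (cochain A).
Local Notation d1 := (koszul_d1 x y z).
Local Notation d2 := (koszul_d2 x y z).

Lemma word_ind_linear (P : A -> Prop) : P 0 ->
  (forall c u v, P u -> P v -> P (c *: u + v)) -> (forall w, P « w ») ->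
  forall a, P a.
Proof.
move=> P0 PD Pw a; rewrite -[a]coordK /lin_ext.
elim: (finmap.enum_fset _) => [|w s IHs]; first by rewrite big_nil.
by rewrite big_cons; apply: PD.
Qed.

Section Lext.
Variables (V : lmodType k) (f : word -> V).

Definition lext (a : A) : V := lin_ext f (coord a).

Lemma lext_linear : linear lext.
Proof. by move=> c u v; rewrite /lext !linearP. Qed.

HB.instance Definition _ := GRing.isLinear.Build k A V _ lext lext_linear.

Lemma lextW w : lext « w » = f w.
Proof. by rewrite /lext coordW lin_extU. Qed.
Lemma lext0 : lext 0 = 0.
Proof. exact: linear0. Qed.
Lemma lextN a : lext (- a) = - lext a.
Proof. exact: linearN. Qed.
Lemma lextD a b : lext (a + b) = lext a + lext b.
Proof. exact: linearD. Qed.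
Definition lextE := (lextW, lext0, lextN, lextD).

End Lext.

Definition ix (a : A) : C1 := (a, 0, 0).
Definition iy (b : A) : C1 := (0, b, 0).
Definition iz (c : A) : C1 := (0, 0, c).

Lemma cochainE (f : C1) : f = ix f.1.1 + iy f.1.2 + iz f.2.
Proof.
case: f => [[a b] c] /=; rewrite /ix /iy /iz.
by congr (_, _, _); rewrite /= ?addr0 ?add0r.
Qed.

Lemma ix_linear : linear ix.
Proof. by move=> c a b; congr (_, _, _); rewrite /= ?scaler0 ?addr0. Qed.
Lemma iy_linear : linear iy.
Proof. by move=> c a b; congr (_, _, _); rewrite /= ?scaler0 ?addr0. Qed.
Lemma iz_linear : linear iz.
Proof. by move=> c a b; congr (_, _, _); rewrite /= ?scaler0 ?addr0. Qed.

HB.instance Definition _ := GRing.isLinear.Build k A C1 _ ix ix_linear.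
HB.instance Definition _ := GRing.isLinear.Build k A C1 _ iy iy_linear.
HB.instance Definition _ := GRing.isLinear.Build k A C1 _ iz iz_linear.

Lemma ixN a : ix (- a) = - ix a. Proof. exact: linearN. Qed.
Lemma iyN a : iy (- a) = - iy a. Proof. exact: linearN. Qed.
Lemma izN a : iz (- a) = - iz a. Proof. exact: linearN. Qed.
Lemma ix0 : ix 0 = 0. Proof. exact: linear0. Qed.
Lemma iy0 : iy 0 = 0. Proof. exact: linear0. Qed.
Lemma iz0 : iz 0 = 0. Proof. exact: linear0. Qed.
Lemma ixD a b : ix (a + b) = ix a + ix b. Proof. exact: linearD. Qed.
Lemma iyD a b : iy (a + b) = iy a + iy b. Proof. exact: linearD. Qed.
Lemma izD a b : iz (a + b) = iz a + iz b. Proof. exact: linearD. Qed.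
Definition iE := (ixN, iyN, izN, ix0, iy0, iz0, ixD, iyD, izD).

Definition basic_cocycle (j : J) : C1 :=
  match j with
  | JB n => ix « Wyx n 0 » + iy « Wy n.+1 »
  | JC n => ix « Wyx n.+1 0 » - iy « Wyx 0 n.+1 » + iz « Wz 0 0 [::] n.+1 »
  | JD i j => ix « Wyx (i.+1 + j.+1) 0 » - iy « Wyx i.+1 j.+1 »
  | JE n l s q => iy « Wz n.+1 l s q.+1 »
  | JG l s q => iy « Wz 0 l.+1 s q.+2 » - iz « Wz 0 0 (l.+1 :: s) q.+1 »
  | JH s => iz « Wz 0 0 s 0 »
  end.

(** Each proposed cocycle has a word in its y coordinate, or in its z coordinate for type H, that
    occurs there in no other one. [piy] and [piz] read the coefficient of this word, with the sign
    that makes it 1. *)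
Definition piy (w : word) : {malg k[J]} :=
  match w with
  | Wy n.+1 => << JB n >>
  | Wyx 0 m.+1 => - << JC m >>
  | Wyx n.+1 m.+1 => - << JD n m >>
  | Wz n.+1 l s q.+1 => << JE n l s q >>
  | Wz 0 l.+1 s q.+2 => << JG l s q >>
  | _ => 0
  end.
Definition piz (w : word) : {malg k[J]} :=
  if w is Wz 0 0 s 0 then << JH s >> else 0.

Definition class_of (f : C1) : {malg k[J]} := lext piy f.1.2 + lext piz f.2.

Lemma class_of_linear : linear class_of.
Proof.
by move=> c u v; rewrite /class_of !linearP /= scalerDr addrACA.
Qed.

HB.instance Definition _ := GRing.isLinear.Build k C1 {malg k[J]} _ class_of
  class_of_linear.

(* [g1], [g2], [g3] give the values on the three coordinates of Hom(V_2, A) of a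
   section of d_2 on the span of the good words: they recover a good word from
   its coboundary, up to the proposed cocycles. *)
Definition g2 (w : word) : C1 :=
  match w with
  | Wz 0 n.+1 s q => iz « Wz n.+1 0 s q »
  | Wz n.+1 l.+1 s q => - iz « Wz n l.+1 s q »
  | Wz n.+1 0 [::] 0 => ix « Wyx n 0 »
  | _ => 0
  end.

(** [g1S n l s q] is the value of [g1] at [Wz n l.+1 s q], and [g1one n s] its value at
    [Wz n 0 s 1]. They are split off because [g1] subtracts such values: besides its leading word
    [Wz n.+1 0 s q], the coboundary of [Wz n 0 s q] in the x coordinate may contain [Wz 0 n s q] and
    [Wz n 0 s 1]. Only q = 1 counts in [g1S], since for a = [Wz n l.+1 s 0] the terms x a and y a
    cancel and a x is left. *)
Definition g1S (n l : nat) (s : seq nat) (q : nat) : C1 :=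
  if q is 1 then ix « Wz n l.+1 s 0 » - g2 (Wz n l.+1 (rcons s 0%N) 0) else 0.

Definition g1one (n : nat) (s : seq nat) : C1 :=
  match n with
  | 0 => 0
  | 1 => ix « Wz 0 0 s 1 »
  | m.+2 => ix « Wz m.+1 0 s 1 » - g1S 0 m s 1
  end.

Definition g1 (w : word) : C1 :=
  match w with
  | Wy n.+1 => ix « Wy n »
  | Wyx n.+1 0 => - ix « Wyx n 0 »
  | Wz n l.+1 s q => g1S n l s q
  | Wz n.+1 0 s q =>
      ix « Wz n 0 s q » - (if n is m.+1 then g1S 0 m s q else 0)
      - (if q is 0 then g1one n s else 0)
  | _ => 0
  end.

Definition g3 (w : word) : C1 :=
  match w with
  | Wy n.+1 => iz « Wy n »
  | Wyx n m.+1 => iz « Wyx n m »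
  | Wz 0 0 s q.+2 => iz « Wz 0 0 s q.+1 »
  | Wz 0 0 [::] 0 => iy « Wy 0 »
  | Wz 0 0 [::] 1 => iy « Wyx 0 0 » - ix « Wyx 0 0 »
  | Wz 0 0 (l :: s) 1 => iy « Wz 0 l s 1 »
  | Wz 0 0 (l :: s) 0 => iy « Wz 0 l s 0 » - g1 (Wz 0 l s 1)
  | _ => 0
  end.

(** On a cocycle the last bracket vanishes, so a zero defect puts [f] in the span of the proposed
    cocycles. *)
Definition defect (f : C1) : C1 :=
  f - lin_ext basic_cocycle (class_of f)
  - (lext g1 (d2 f).1.1 + lext g2 (d2 f).1.2 + lext g3 (d2 f).2).

Lemma defect_linear : linear defect.
Proof.
move=> c u v; rewrite /defect !linearP /= !(scalerDr, scalerN, opprD).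
by rewrite [LHS](AC (2*2*((2*2)*2)) (1*3*(5*7*9)*(2*4*(6*8*10)))).
Qed.

HB.instance Definition _ := GRing.isLinear.Build k C1 C1 _ defect
  defect_linear.

Lemma defect_ix a :
  defect (ix a) = ix a - (lext g1 (x * a + y * a + a * x) + lext g2 (a * z)).
Proof.
rewrite /defect /class_of /= !lext0 add0r linear0 subr0.
by rewrite mulr0 mul0r !addr0 mulr0 add0r mul0r addr0 lext0 addr0 mulrDl.
Qed.

Lemma defect_iy b : defect (iy b) =
  iy b - lin_ext basic_cocycle (lext piy b) - (lext g1 (b * x) + lext g3 (z * b)).
Proof.
rewrite /defect /class_of /= !lext0 addr0.
by rewrite !mulr0 !mul0r !add0r !addr0 lext0 addr0.
Qed.

Lemma defect_iz c : defect (iz c) =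
  iz c - lin_ext basic_cocycle (lext piz c) - (lext g2 (x * c) + lext g3 (c * y)).
Proof.
rewrite /defect /class_of /= !lext0 add0r.
by rewrite !mulr0 !mul0r !add0r !addr0 lext0 add0r.
Qed.

(* A word is bad in a given coordinate if it is the leading term there of the
   coboundary of a word. *)
Definition badx (w : word) : bool :=
  match w with
  | Wyx 0 _.+1 | Wyx _.+1 _.+1 => true
  | Wz _ _.+1 _ _.+1 => true
  | _ => false
  end.

Definition bady (w : word) : bool :=
  match w with
  | Wyx _.+1 0 | Wz _.+1 _ _ 0 | Wz 0 0 _ _.+2 => true
  | _ => false
  end.

Let wE := (xWE xx xz, yWE x y z, zWE x zy, WxE xx zy, WyE x zy, WzE y xz).
Let cE := (@addr0 C1, @add0r C1, @subr0 C1, @sub0r C1,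
  @oppr0 C1, @opprK C1, @addNr C1, @addrN C1, @addrK C1, @subrK C1,
  @subrKC C1, @subKr C1).

Lemma defectx0 w : ~~ badx w -> defect (ix « w ») = 0.
Proof.
rewrite defect_ix.
(* The split of the leading exponent into 0, 1 and at least 2 mirrors [g1one]. *)
case: w => [[|n]|[|n] [|m]|[|[|n]] [|l] [|t s] [|[|q]]] //= _;
  by rewrite !wE ?lextE /= ?addn0 ?cE.
Qed.

Lemma defecty0 w : ~~ bady w -> defect (iy « w ») = 0.
Proof.
rewrite defect_iy lextW.
case: w => [[|n]|[|n] [|m]|[|n] [|l] [|t s] [|[|q]]] //= _;
  rewrite !wE ?lextE /= ?lin_extE /= ?add0n ?cE //.
- by rewrite opprD addrCA subrr addr0 addNr.
- by rewrite [X in _ + X - _]addrAC !cE.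
Qed.

Lemma defectz0 w : defect (iz « w ») = 0.
Proof.
rewrite defect_iz lextW.
case: w => [[|n]|[|n] m|[|n] [|l] [|t s] [|[|q]]] /=;
  by rewrite !wE ?lextE /= ?lin_extE /= ?cE.
Qed.

(** * Reduction of every cochain to good words modulo coboundaries *)

Lemma d1E a : d1 a = ix (x * a - a * x) + iy (y * a - a * y) + iz (z * a - a * z).
Proof. exact: cochainE. Qed.

(** The reducible cochains form a subspace containing the good words and the coboundaries; only the
    bad words remain to be reached. *)
Definition reducible (f : C1) := exists t, defect (f - d1 t) = 0.

Lemma reducibleP c u v : reducible u -> reducible v -> reducible (c *: u + v).
Proof.
move=> [s us] [t vt]; exists (c *: s + t).
have -> : c *: u + v - d1 (c *: s + t) = c *: (u - d1 s) + (v - d1 t).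
  by rewrite linearP opprD scalerBr [LHS](AC (2*2) ((1*3)*(2*4))).
by rewrite linearP /= us vt scaler0 addr0.
Qed.

Lemma reducible0 f : defect f = 0 -> reducible f.
Proof. by exists 0; rewrite linear0 subr0. Qed.

Lemma reducible_d1 t : reducible (d1 t).
Proof. by exists t; rewrite subrr linear0. Qed.

Lemma reducibleD u v : reducible u -> reducible v -> reducible (u + v).
Proof. by move=> ru rv; rewrite -[u]scale1r; apply: reducibleP. Qed.

Lemma reducibleN u : reducible u -> reducible (- u).
Proof.
move=> ru; rewrite -[- u]addr0 -scaleN1r; apply: reducibleP => //.
by apply: reducible0; rewrite linear0.
Qed.

Lemma reducibleNK u : reducible (- u) -> reducible u.
Proof. by move/reducibleN; rewrite opprK. Qed.

Lemma reducibleDl u v : reducible (u + v) -> reducible u -> reducible v.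
Proof. by move=> ruv /reducibleN ru; rewrite -[v](addKr u); apply: reducibleD. Qed.

Lemma reducibleDr u v : reducible (u + v) -> reducible v -> reducible u.
Proof. by rewrite addrC; apply: reducibleDl. Qed.

Lemma reducible_linear (i : {linear A -> C1}) :
  (forall w, reducible (i « w »)) -> forall a, reducible (i a).
Proof.
move=> iw; apply: word_ind_linear => // [|c u v iu iv].
  by apply: reducible0; rewrite !linear0.
by rewrite linearP /=; apply: reducibleP.
Qed.

Lemma reducible_iz a : reducible (iz a).
Proof. by apply: reducible_linear => w; apply/reducible0/defectz0. Qed.

Lemma reducible_step a : reducible (ix (x * a - a * x) + iy (y * a - a * y)).
Proof.
apply: reducibleDr (reducible_iz (z * a - a * z)).
by rewrite -d1E; apply: reducible_d1.
Qed.

Lemma reducible_iyB w w' : ~~ bady w -> ~~ bady w' ->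
  reducible (iy « w » - iy « w' »).
Proof.
by move=> gw gw'; apply: reducibleD; [|apply: reducibleN];
  apply/reducible0/defecty0.
Qed.

(** Each bad word leads the coboundary of one explicit word, and all other terms in the x and y
    coordinates are good, so no induction on words is needed. *)
Lemma reducible_ix a : reducible (ix a).
Proof.
apply: reducible_linear => w.
have [|/defectx0] := boolP (badx w); last exact: reducible0.
case: w => [//|[|n] [|m] // _|[|n] [//|l] s [//|q] _].
- move: (reducible_step « Wy m.+1 »); rewrite !wE subrr !iE addr0.
  move/reducibleDr; apply; apply/reducibleN/reducible0; exact: defectx0.
- have g : ~~ bady (Wyx n m.+2) by case: n.
  move: (reducible_step « Wyx n m.+1 »); rewrite !wE opprK !iE.
  move/reducibleDr => /(_ (@reducible_iyB (Wyx n.+1 m.+1) _ isT g)).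
  move/reducibleDr => h; apply/reducibleNK/h/reducible0; exact: defectx0.
- move: (reducible_step « Wz l.+1 0 s q.+1 »); rewrite !wE subr0 !iE.
  by move/reducibleDr; apply; apply: reducible_iyB.
- move: (reducible_step « Wz n l.+1 s q.+1 »); rewrite !wE subr0 !iE.
  move/reducibleDr => h; apply/reducibleNK/h/reducible_iyB => //; by case: n {h}.
Qed.

(** Here the coboundary led by a bad word may have bad words in its x coordinate; these are covered
    by [reducible_ix]. *)
Lemma reducible_iy a : reducible (iy a).
Proof.
apply: reducible_linear => w.
have [|/defecty0] := boolP (bady w); last exact: reducible0.
case: w => [//|[//|n] [|m] // _|[|n] [|l] s [|[|q]] // _].
- move: (reducible_step « Wyx n 0 »); rewrite !wE addn0 subrr ix0 add0r !iE.
  move/reducibleDr; apply; apply/reducibleN/reducible0; apply: defecty0.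
  by case: n.
- move: (reducible_step « Wz 0 0 s q.+1 »); rewrite !wE subrr ix0 add0r !iE.
  move/reducibleDl => h; apply/reducibleNK/h/reducible0; exact: defecty0.
- move: (reducible_step « Wz n 0 s 0 »); rewrite Wz0y // subr0 yWz.
  by move/reducibleDl; apply; apply: reducible_ix.
- move: (reducible_step « Wz n l.+1 s 0 »); rewrite Wz0y // subr0 yWz.
  by move/reducibleDl; apply; apply: reducible_ix.
Qed.

Lemma all_reducible f : reducible f.
Proof.
rewrite [f]cochainE; apply: reducibleD (reducible_iz _).
exact: reducibleD (reducible_ix _) (reducible_iy _).
Qed.

Lemma basic_span f : d2 f = 0 -> exists u t, f = lin_ext basic_cocycle u + d1 t.
Proof.
move=> f0; have [t] := all_reducible f; set u := f - d1 t => du.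
have u0 : d2 u = 0.
  have -> : d2 u = d2 f - d2 (d1 t) := linearB _ _ _.
  by rewrite f0 koszul_d2_d1 // subr0.
exists (class_of u), t; apply/eqP; rewrite -subr_eq -subr_eq0 -/u.
by move: du; rewrite /defect u0 /= !lext0 !addr0 subr0 => ->.
Qed.

Let aE := (@mulr0 A, @mul0r A, @mulrN A, @mulNr A, @addr0 A, @add0r A, @subr0 A, @sub0r A,
  @oppr0 A, @opprK A, @addNr A, @addrN A, @addrK A, @subrK A,
  @subrKC A, @subKr A).

Lemma basic_is_cocycle j : d2 (basic_cocycle j) = 0.
Proof.
case: j => [n|n|i j|n l s q|l s q|s]; congr (_, _, _);
  by rewrite /= !aE ?[(x + y) * _]mulrDl ?wE ?addn0 ?aE.
Qed.

(* [hx] and [hy] send a bad word to the element whose coboundary it leads. *)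
Definition hx (w : word) : A :=
  match w with
  | Wyx 0 n.+1 => « Wy n.+1 »
  | Wyx n.+1 m.+1 => - « Wyx n m.+1 »
  | Wz n.+1 l.+1 s q.+1 => - « Wz n l.+1 s q.+1 »
  | Wz 0 n.+1 s q.+1 => « Wz n.+1 0 s q.+1 »
  | _ => 0
  end.

Definition hy (w : word) : A :=
  match w with
  | Wyx n.+1 0 => « Wyx n 0 »
  (* The coboundary of [Wz n l s 0] has - [Wz n l s 1] in its x coordinate; the second summand
     cancels the contribution of [hx] there. *)
  | Wz n.+1 l s 0 => « Wz n l s 0 » + hx (Wz n l s 1)
  | Wz 0 0 s q.+2 => - « Wz 0 0 s q.+1 »
  | _ => 0
  end.

Definition homotopy (f : C1) : A := lext hx f.1.1 + lext hy f.1.2.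

Lemma homotopy_linear : linear homotopy.
Proof. by move=> c u v; rewrite /homotopy !linearP /= scalerDr addrACA. Qed.

HB.instance Definition _ := GRing.isLinear.Build k C1 A _ homotopy
  homotopy_linear.

(** The word 1 is central, so its coboundary is zero and no homotopy can recover it. *)
Definition const_word (w : word) : A := if w is Wy 0 then « Wy 0 » else 0.
Definition const_part : A -> A := lext const_word.

HB.instance Definition _ := GRing.isLinear.Build k A A _ const_part
  (lext_linear const_word).

Lemma homotopy_d1 a : homotopy (d1 a) = a - const_part a.
Proof.
elim/word_ind_linear: a => [|c u v hu hv|w].
- by rewrite !linear0 ?subr0 ?addr0.
- by rewrite !linearP /= hu hv scalerBr scalerN addrACA.
rewrite /homotopy /const_part lextW /=.
case: w => [[|n]|[|n] [|m]|[|n] [|l] s [|q]];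
  by rewrite !wE ?lextE /= ?addn0 ?aE // addrC addrK.
Qed.

Lemma d1_const_part a : d1 (const_part a) = 0.
Proof.
elim/word_ind_linear: a => [|c u v hu hv|w].
- by rewrite !linear0.
- by rewrite !linearP /= hu hv scaler0 addr0.
rewrite /const_part lextW; case: w => [[|n]|n m|n l s q]; rewrite /= ?linear0 //.
have -> : « Wy 0 » = 1 := expr0 y.
by rewrite d1E !mulr1 !mul1r !subrr !iE !addr0.
Qed.

(** The x and y coordinates of the proposed cocycles contain no bad word. *)
Lemma homotopy_basic j : homotopy (basic_cocycle j) = 0.
Proof.
case: j => [n|n|i j|n l s q|l s q|s]; rewrite /homotopy /=;
  rewrite ?addr0 ?add0r ?lextE /= ?aE //.
by case: n.
Qed.

Lemma class_of_basic j : class_of (basic_cocycle j) = << j >>.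
Proof.
case: j => [n|n|i j|n l s q|l s q|s]; rewrite /class_of /=;
  by rewrite ?addr0 ?add0r ?lextE /= !(opprK, oppr0, addr0, add0r).
Qed.

(** Applying [homotopy] to the equation shows that t is a constant, hence d_1 t = 0, and [class_of]
    then gives u = 0. *)
Lemma basic_indep u t : lin_ext basic_cocycle u = d1 t -> u = 0.
Proof.
move=> ut.
have hu v : homotopy (lin_ext basic_cocycle v) = 0.
  rewrite /lin_ext linear_sum big1 // => j _.
  by rewrite linearZ /= homotopy_basic scaler0.
have cu v : class_of (lin_ext basic_cocycle v) = v.
  rewrite /lin_ext linear_sum [RHS]malg_sumU; apply: eq_bigr => j _.
  by rewrite linearZ /= class_of_basic.
have t0 : t = const_part t.
  by apply/eqP; rewrite -subr_eq0 -homotopy_d1 -ut hu.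
by rewrite -[u]cu ut t0 d1_const_part linear0.
Qed.

End Homotopy.

(** * Chains of z's encoded by the exponent sequences n and m *)

(* A chain z (gap s_1) z ... (gap s_r) z is z^m times a product of blocks
   x y^n z^m'; [blocks s] lists the first exponent and the pairs (n, m'). *)
Fixpoint blocks (s : seq nat) : nat * seq (nat * nat) :=
  if s is l :: s' then
    let: (m, bs) := blocks s' in if l is 0 then (m.+1, bs) else (1%N, (l, m) :: bs)
  else (1%N, [::]).

Definition z_exps (s : seq nat) : seq nat := (blocks s).1 :: unzip2 (blocks s).2.
Definition y_exps (s : seq nat) : seq nat := unzip1 (blocks s).2.

Lemma all_pos_rcons s n : all_pos (rcons s n) = (0 < n)%N && all_pos s.
Proof. exact: all_rcons. Qed.

Lemma blocks_pos s : [/\ all_pos (z_exps s), all_pos (y_exps s) &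
  size (z_exps s) = (size (y_exps s)).+1].
Proof.
rewrite /z_exps /y_exps /all_pos; split; last by rewrite /= !size_map.
  elim: s => //= l s; case: (blocks s) => m bs /=; case: l => [|l] /andP[m0 h] //=.
elim: s => //= l s; case: (blocks s) => m bs /=; case: l => [|l] //=.
Qed.

(** The preimage consists of m_1 - 1 zeros, n_2, m_2 - 1 zeros, n_3, and so on; the outer induction
    runs over the blocks, the inner one over the leading exponent of z. *)
Lemma blocks_surj (ns ms : seq nat) :
    (0 < size ms)%N -> size ns = (size ms - 1)%N -> all_pos ns -> all_pos ms ->
  exists s, y_exps s = ns /\ z_exps s = ms.
Proof.
case: ms => [//|m ms] _ /=; rewrite subn1 /= => e pn /andP[m0 pm].
suff [s es] : exists s, blocks s = (m, zip ns ms).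
  by exists s; rewrite /y_exps /z_exps es /= unzip1_zip ?unzip2_zip ?e.
elim: ms ns m m0 e pn pm => [|m' ms IH] [|n ns] //= m m0 e pn pm;
  elim: m m0 => [//|[|m] IHm] _.
- by exists [::].
- by have [s es] := IHm isT; exists (0%N :: s); rewrite /= es.
- case/andP: pn => n0 pn; case/andP: pm => m'0 pm.
  have [s es] := IH ns m' m'0 (succn_inj e) pn pm.
  by exists (n :: s); rewrite /= es; case: (n) n0.
- by have [s es] := IHm isT; exists (0%N :: s); rewrite /= es.
Qed.

(** The successors turn parameters that range freely over the naturals into positive exponents. *)
Definition name_of (j : hh1_class_name) : hh1_name :=
  match j with
  | JB 0 => cocA
  | JB n => cocB n
  | JC n => cocC n.+1
  | JD i j => cocD (i.+1 + j.+1) i.+1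
  | JE n 0 s q => cocF (n.+1 :: rcons (y_exps s) q.+1) (z_exps s)
  | JE n l s q => cocE (n.+1 :: l :: rcons (y_exps s) q.+1) (z_exps s)
  | JG l s q => cocG (l.+1 :: rcons (y_exps s) q.+1) (z_exps s)
  | JH s => cocH (y_exps s) (z_exps s)
  end.

Lemma name_of_range j : hh1_range (name_of j).
Proof.
case: j => [[|n]|n|i j|n [|l] s q|l s q|s] //=.
- by rewrite addnS /= leq_addr.
all: have [pz py [sz]] := blocks_pos s; move: pz => /= pz.
all: by rewrite ?all_pos_rcons ?size_rcons py pz sz ?addn1 ?addn2 ?subn1 /= ?eqxx.
Qed.

Definition index_of (j : hh1_class_name) : hh1_index :=
  exist _ (name_of j) (name_of_range j).

Lemma index_of_surj i : exists j, index_of j = i.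
Proof.
suff [j ji] : exists j, name_of j = val i by exists j; apply: val_inj.
case: i => [[|n|n|n i|ns ms|ns ms|ns ms|ns ms]] /= hi.
- by exists (JB 0).
- by case: n hi => // n _; exists (JB n.+1).
- by case: n hi => // n _; exists (JC n).
(* The second parameter solves n = i.+1 + j.+1. *)
- case: i hi => //= i hi; exists (JD i (n - i.+2)) => /=; congr cocD.
  by move: hi; case: n => [|n] //= hi; rewrite -subSn // subSS addnC subnK // ltnW.
- case/and4P: hi => m0 /eqP; case: ns => [|[|n0] [|[|n1] ns]]; rewrite ?addn2 //=.
  (* Removing the last exponent n_{p+1} leaves n_2, ..., n_p for [blocks_surj]; if there were none
     to remove, p would be 0. *)
  case/lastP: ns => [|ns [|q]] e; rewrite /= ?all_pos_rcons //= => pn pm.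
    by case: e m0 => <-.
  have [|s [<- <-]] := blocks_surj m0 _ pn pm.
    by case: e; rewrite size_rcons => <-; rewrite subn1.
  by exists (JE n0 n1.+1 s q).
- case/and4P: hi => m0 /eqP; case: ns => [|[|n0] ns]; rewrite ?addn1 //=.
  case/lastP: ns => [|ns [|q]] e; rewrite /= ?all_pos_rcons //= => pn pm.
    by case: e m0 => <-.
  have [|s [<- <-]] := blocks_surj m0 _ pn pm.
    by case: e; rewrite size_rcons => <-; rewrite subn1.
  by exists (JE n0 0 s q).
- case/and4P: hi => m0 /eqP; case: ns => [|[|n0] ns]; rewrite ?addn1 //=.
  case/lastP: ns => [|ns [|q]] e; rewrite /= ?all_pos_rcons //= => pn pm.
    by case: e m0 => <-.
  have [|s [<- <-]] := blocks_surj m0 _ pn pm.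
    by case: e; rewrite size_rcons => <-; rewrite subn1.
  by exists (JG n0 s q).
- case/and4P: hi => m0 /eqP e pn pm.
  by have [s [<- <-]] := blocks_surj m0 e pn pm; exists (JH s).
Qed.

(** * Agreement of the two descriptions of the cochains *)

Section Translation.
Variables (k : fieldType) (A : algType k) (x y z : A).

Lemma zchain_cons l s :
  zchain x y z (l :: s) = z * gap x y l * zchain x y z s.
Proof. by rewrite /zchain big_cons !mulrA. Qed.

Lemma zchain_blocks s : zchain x y z s =
  z ^+ (blocks s).1 * \prod_(b <- (blocks s).2) (x * y ^+ b.1 * z ^+ b.2).
Proof.
elim: s => [|l s IHs]; first by rewrite /zchain !big_nil.
rewrite zchain_cons IHs /=; case: (blocks s) => m bs /=; case: l => [|l] /=.
  by rewrite mulr1 mulrA exprS.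
by rewrite big_cons expr1 !mulrA.
Qed.

Lemma exp_last1 n s q :
  from 1 (n :: rcons (y_exps s) q) (size (z_exps s)).+1 = q.
Proof.
have [_ _ ->] := blocks_pos s.
by rewrite /from subn1 /= nth_rcons ltnn eqxx.
Qed.

Lemma exp_last0 n l s q :
  from 0 (n :: l :: rcons (y_exps s) q) (size (z_exps s)).+1 = q.
Proof.
have [_ _ ->] := blocks_pos s.
by rewrite /from subn0 /= nth_rcons ltnn eqxx.
Qed.

(** The first power of z has no n_1 before it, whence the shift by 2. Other values of [n] are left
    free, as they belong to the factors around the chain. *)
Lemma zword_z_exps s (n : nat -> nat) :
    (forall j, (j < size (y_exps s))%N -> n j.+2 = nth 0%N (y_exps s) j) ->
  zword x y z (size (z_exps s)) n (from 1 (z_exps s)) = zchain x y z s.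
Proof.
move=> hn; rewrite zchain_blocks /zword; congr (_ * _).
rewrite (big_nth (0%N, 0%N)) /= size_map -[2%N]add0n big_addn subn2 /=.
rewrite !big_mkord; apply: eq_bigr => -[j js] _ /=.
rewrite addn2 hn; last by rewrite size_map.
rewrite /from subn1 /= (nth_map (0%N, 0%N)) //.
by rewrite (nth_map (0%N, 0%N)).
Qed.

Lemma hh1_cochain_index_of j : hh1_cochain x y z (index_of j) = basic_cocycle x y z j.
Proof.
case: j => [[|n]|n|i j|n [|l] s q|l s q|s];
  rewrite /hh1_cochain /basic_cocycle /wordA /ix /iy /iz [val _]/=;
  congr (_, _, _); rewrite /= ?subr0 ?sub0r ?addr0 ?add0r ?expr0 ?expr1
    ?mulr1 ?mul1r ?addKn //.
- by rewrite /zchain big_nil mulr1 mulrA.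
- rewrite zword_z_exps ?exp_last1 ?mulrA // => j js.
  by rewrite /from subn1 /= nth_rcons js.
- rewrite zword_z_exps ?exp_last0 ?mulrA // => j js.
  by rewrite /from subn0 /= nth_rcons js.
- rewrite zword_z_exps ?exp_last1 ?mulrA // => j js.
  by rewrite /from subn1 /= nth_rcons js.
- rewrite zword_z_exps ?exp_last1 => [|j js].
    by rewrite zchain_cons !mulrA.
  by rewrite /from subn1 /= nth_rcons js.
- by apply: zword_z_exps => j _; rewrite /from subn2.
Qed.

End Translation.

(** * Linear combinations and representatives of cohomology classes *)

Section CohomologyClasses.
Variables (k : fieldType) (V0 V1 V2 : lmodType k).
Variables (d1 : {linear V0 -> V1}) (d2 : {linear V1 -> V2}).
Local Open Scope quotient_scope.
Local Notation B := (coboundary d1 (d2 := d2)).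

Lemma coh_class_eq (f g : V1) (hf : cocycle d2 f) (hg : cocycle d2 g) a :
  f = g + d1 a -> coh_class d1 hf = coh_class d1 hg.
Proof.
move=> e; apply/lquot_piP/asboolP; exists a.
by rewrite [LHS](linearB val) /= e addrC addKr.
Qed.

Lemma coh_class_sum (r : nat) (c : 'I_r -> k) (f : 'I_r -> V1)
    (hf : forall j, cocycle d2 (f j)) :
  exists hs : cocycle d2 (\sum_(j < r) c j *: f j),
    \sum_(j < r) c j *: coh_class d1 (hf j) = coh_class d1 hs.
Proof.
pose u : cocycles d2 := \sum_(j < r) c j *: Cocycle (hf j).
have vu : val u = \sum_(j < r) c j *: f j.
  by rewrite linear_sum; apply: eq_bigr => j _; rewrite linearZ.
have hs : cocycle d2 (\sum_(j < r) c j *: f j) by rewrite -vu; apply: valP.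
exists hs.
have -> : coh_class d1 hs = \pi_(lquot B) u.
  by congr (\pi_(lquot B) _); apply: val_inj.
have pi0 : \pi_(lquot B) 0 = 0.
  by apply: (addrI (\pi_(lquot B) 0)); rewrite -lquot_piD !addr0.
rewrite (big_morph _ (@lquot_piD _ _ B) pi0).
by apply: eq_bigr => j _; apply: lquot_scaleE.
Qed.

Lemma coh_classP (v : cohomology d1 d2) :
  exists f (hf : cocycle d2 f), v = coh_class d1 hf.
Proof.
case e : (generic_quotient.repr (v : lquot B)) => [f hf].
exists f, hf; rewrite /coh_class -e; exact/esym/generic_quotient.reprK.
Qed.

End CohomologyClasses.

(** * The basis of the cohomology, from the coordinates on normal words *)

Lemma hh1_basis (k : fieldType) (A : algType k) (x y z : A)
    (coord : {linear A -> {malg k[word]}}) :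
    x ^+ 2 + y * x = 0 -> x * z = 0 -> z * y = 0 ->
    (forall w, coord (wordA x y z w) = << w >>) ->
    cancel coord (lin_ext (wordA x y z)) ->
  exists hZ : forall i : hh1_index,
      cocycle (koszul_d2 x y z) (hh1_cochain x y z i),
    is_basis (fun i : hh1_index => HHm1_class (hZ i)).
Proof.
move=> xx xz zy coordW coordK.
(* Independence uses that a section of [index_of] is injective; spanning uses [index_of] itself. *)
have [tau tauK] := choice index_of_surj.
have Ztau i : hh1_cochain x y z i =
    basic_cocycle x y z (tau i).
  by rewrite -hh1_cochain_index_of tauK.
have hZ i : cocycle (koszul_d2 x y z)
    (hh1_cochain x y z i).
  by rewrite Ztau; apply/eqP; apply: basic_is_cocycle xx xz zy _.
exists hZ; split=> [r s c s_inj|v].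
- have [hs ->] := coh_class_sum (koszul_d1 x y z) c (fun j => hZ (s j)).
  case/coh_class_eq0 => t ht j.
  pose u : {malg k[hh1_class_name]} := \sum_(i < r) c i *: << tau (s i) >>.
  have u0 : u = 0.
    apply: (basic_indep xx xz zy coordW coordK (t := t)).
    rewrite -ht linear_sum; apply: eq_bigr => i _.
    by rewrite linearZ /= lin_extU Ztau.
  have tauI : injective tau by apply: can_inj tauK.
  move: (congr1 (mcoeff (tau (s j))) u0); rewrite mcoeff0 raddf_sum.
  rewrite (bigD1 j) //= mcoeffZ mcoeffUU mulr1 big1 ?addr0 // => i ij.
  rewrite mcoeffZ mcoeffU; case: (tau (s i) =P tau (s j)) => [/tauI/s_inj e|_].
    by rewrite e eqxx in ij.
  by rewrite mulr0.
- have [f [hf ->]] := coh_classP v.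
  have [u [t e]] := basic_span xx xz zy coordW coordK (eqP hf).
  pose js := in_tuple (finmap.enum_fset (msupp u)).
  exists (size js), (fun i => index_of (tnth js i)), (fun i => u@_(tnth js i)).
  have [hs ->] := coh_class_sum (koszul_d1 x y z)
    (fun i => u@_(tnth js i)) (fun i => hZ (index_of (tnth js i))).
  apply: (@coh_class_eq _ _ _ _ _ _ _ _ _ _ t); rewrite e; congr (_ + _).
  rewrite /lin_ext big_tnth; apply: eq_bigr => i _.
  by rewrite hh1_cochain_index_of.
Qed.

Theorem proposition3p6 (k : fieldType) (char0 : [pchar k] =i pred0) :
  exists hZ : forall i : hh1_index,
      cocycle (koszul_d2 (xA k) (yA k) (zA k)) (hh1_cochain (xA k) (yA k) (zA k) i),
    is_basis (fun i : hh1_index => HHm1_class (hZ i)).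
Proof.
by have [xx xz zy] := algA_rels k; apply: hh1_basis xx xz zy (@coordW k) (@coordK k).
Qed.
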